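(* Let $G_n=P_n$, the path with $n$ nodes, or $G_n=C_n$, the cycle with $n$ nodes. Then the family $(G_n)$ belongs to a spectral class $\rho$ that has no atoms, that is, $\rho(A)=0$ whenever $A$ is a finite subset of $[0,2]$. In fact, $\rho$ is absolutely continuous with respect to the Lebesgue measure on $[0,2]$, with probability density function $$g(x)=\frac{1}{\pi}\frac{1}{\sqrt{2x-x^2}}.$$
   Context: For a simple graph $G=(V,E)$ with $N=|V|$ vertices, the normalized Laplacian acts on functions $f:V\to\mathbb{R}$ by $\Delta_G f(x)=f(x)-\frac{1}{d_x}\sum_{y\sim x}f(y)$, where $d_x$ is the degree of $x$. Its spectrum consists of $N$ eigenvalues (with multiplicity) $0=\lambda_0\le\cdots\le\lambda_{N-1}\le 2$. The associated probability measure on $[0,2]$ is $\mu(G)=\frac1N\sum_{i=0}^{N-1}\delta_{\lambda_i}$, where $\delta_a$ is the Dirac measure at $a$. A family $(G_n)$ of graphs belongs to the spectral class $\rho$, where $\rho$ is a Radon measure on $[0,2]$, if $\mu(G_n)$ converges weakly to $\rho$ as $n\to\infty$, i.e. $\int f\,d\mu(G_n)\to\int f\,d\rho$ for all continuous $f:[0,2]\to\mathbb{R}$. *)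

(* Defs.v *)
From mathcomp Require Import all_boot all_order all_algebra.
From mathcomp Require Import all_classical all_reals all_analysis.
From mathcomp Require complex.
From mathcomp Require Import ring.
Import Order.TTheory GRing.Theory Num.Theory.
Import numFieldNormedType.Exports.

Set Implicit Arguments.
Unset Strict Implicit.
Unset Printing Implicit Defensive.

Local Open Scope classical_set_scope.
Local Open Scope ring_scope.

Record sgraph := SGraph {
  vertex : finType;
  adj : rel vertex;
  adj_sym : symmetric adj;
  adj_irr : irreflexive adj }.

Arguments adj : clear implicits.

Definition degree (G : sgraph) (x : vertex G) : nat := #|adj G x|.

(* At an isolated vertex the convention 0^-1 = 0 makes this the identity. *)
Definition laplacian (R : realType) (G : sgraph) (f : vertex G -> R)
    (x : vertex G) : R :=
  f x - (degree x)%:R^-1 * \sum_(y | adj G x y) f y.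

(* Column j is the image of the indicator function of the j-th vertex. *)
Definition laplacian_mx (R : realType) (G : sgraph) : 'M[R]_#|vertex G| :=
  \matrix_(i, j)
    laplacian (fun y => (y == enum_val j)%:R : R) (enum_val i).

Definition is_spectrum (R : realType) (G : sgraph) (s : seq R) : Prop :=
  sorted <=%R s /\
  char_poly (laplacian_mx R G) = \prod_(z <- s) ('X - z%:P).

(* The eigenvalues counted with multiplicity; by [spectrumP] below, the default
   value [::] is never used. *)
Definition spectrum (R : realType) (G : sgraph) : seq R :=
  xget [::] [set s | is_spectrum G s].

(* A real matrix that is self-adjoint for a weighted inner product has only
   real eigenvalues. *)
Section RealEigenvalues.
Import complex.
Local Open Scope complex_scope.

Lemma symmetrizable_char_poly_split (R : rcfType) (n : nat) (A : 'M[R]_n)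
    (w : 'I_n -> R) :
  (forall i, 0 < w i) -> (forall i j, w i * A i j = w j * A j i) ->
  exists s : seq R, char_poly A = \prod_(z <- s) ('X - z%:P).
Proof.
move=> w0 wA; pose toC : {rmorphism R -> R[i]} := real_complex R.
have conjM (a b : R[i]) (x : R) : (a * b^* * toC x)^* = b * a^* * toC x.
  case: a b => [a1 a2] [b1 b2]; apply/eqP.
  by rewrite eq_complex /=; apply/andP; split; apply/eqP; ring.
pose B := map_mx toC A.
have [r] := closed_field_poly_normal (char_poly B).
rewrite (monicP (char_poly_monic B)) scale1r => Er.
have rR z : z \in r -> z = toC (complex.Re z).
  move=> zr; have : root (char_poly B) z by rewrite Er root_prod_XsubC.
  rewrite -eigenvalue_root_char => /eigenvalueP[v vB v0].
  pose c i j := A i j / w j.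
  have cC i j : c i j = c j i.
    apply/eqP; rewrite eqr_div ?(gt_eqF (w0 _))//; apply/eqP.
    by rewrite mulrC wA mulrC.
  pose S := \sum_j \sum_i (v 0 i * (v 0 j)^*) * toC (c i j).
  pose T := \sum_j (v 0 j * (v 0 j)^*) * toC ((w j)^-1).
  have SzT : S = z * T.
    rewrite mulr_sumr; apply: eq_bigr => j _.
    rewrite mulrA mulrA -(_ : (v *m B) 0 j = z * v 0 j); last first.
      by rewrite vB mxE.
    rewrite mxE !mulr_suml; apply: eq_bigr => i _.
    by rewrite mxE rmorphM /= !mulrA; congr (_ * _); rewrite mulrAC.
  have SC : S^* = S.
    rewrite /S rmorph_sum /= exchange_big; apply: eq_bigr => j _.
    rewrite rmorph_sum /=; apply: eq_bigr => i _.
    by rewrite conjM cC.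
  have TC : T^* = T.
    rewrite /T rmorph_sum /=; apply: eq_bigr => j _.
    by rewrite conjM.
  have T0 : T != 0.
    have F0 j : 0 <= v 0 j * (v 0 j)^* * toC (w j)^-1.
      by rewrite mulr_ge0 ?mulcJ_ge0// ler0c invr_ge0 ltW.
    apply: contraNneq v0 => /eqP; rewrite psumr_eq0// => /allP TE.
    apply/eqP/rowP => j; rewrite mxE; have := TE j (mem_index_enum j).
    rewrite /= !mulf_eq0 conjc_eq0 orbb => /orP[/eqP//|].
    by rewrite (fmorph_eq0 toC) invr_eq0 gt_eqF.
  have zC : z^* = z.
    by apply: (mulIf T0); rewrite -{1}TC -rmorphM/= -SzT SC SzT.
  case: z zC {zr vB SzT} => a b /eqP; rewrite eq_complex /= eqxx /=.
  rewrite -subr_eq0 -opprD oppr_eq0 -mulr2n mulrn_eq0 /= => /eqP ->.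
  by [].
exists (map (@complex.Re R) r); apply: (map_poly_inj toC).
rewrite map_char_poly Er rmorph_prod/= big_map big_seq [RHS]big_seq.
apply: eq_bigr => z zr.
by rewrite rmorphB/= map_polyX map_polyC/= {1}(rR z zr).
Qed.
End RealEigenvalues.

Lemma spectrumP (R : realType) (G : sgraph) : is_spectrum G (spectrum R G).
Proof.
pose w (i : 'I_#|vertex G|) : R :=
  if degree (enum_val i) == 0%N then 1 else (degree (enum_val i))%:R.
have w0 i : 0 < w i by rewrite /w; case: eqVneq => // d0; rewrite ltr0n lt0n.
have lapE i j : laplacian_mx R G i j =
    (i == j)%:R - (degree (enum_val i))%:R^-1
                  * (adj G (enum_val i) (enum_val j))%:R.
  rewrite mxE /laplacian (inj_eq enum_val_inj); congr (_ - _ * _).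
  case: (boolP (adj G (enum_val i) (enum_val j))) => a; last first.
    by rewrite big1// => y ya; case: eqVneq => // ye; rewrite -ye ya in a.
  rewrite (bigD1 (enum_val j))//= eqxx big1 ?addr0// => y /andP[_ /negbTE ->].
  by [].
have [s Es] : exists s : seq R,
    char_poly (laplacian_mx R G) = \prod_(z <- s) ('X - z%:P).
  apply: (symmetrizable_char_poly_split w0) => i j.
  have wL i' j' : w i' * laplacian_mx R G i' j' =
      w i' * (i' == j')%:R - (adj G (enum_val i') (enum_val j'))%:R.
    rewrite lapE mulrBr mulrA; congr (_ - _); rewrite /w.
    case: eqVneq => [d0|d0]; last by rewrite divff ?mul1r// pnatr_eq0.
    rewrite d0 invr0 mulr0 mul0r.
    by move/card0_eq: d0 => /(_ (enum_val j')); rewrite inE /in_mem/= => ->.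
  by rewrite !wL adj_sym eq_sym; case: eqVneq => [->|]; rewrite ?mulr0.
rewrite /spectrum; apply: (@xgetI _ [::] [set s | is_spectrum G s] (sort <=%R s)).
split; first exact: (sort_sorted le_total).
by rewrite Es; apply: perm_big; rewrite perm_sym perm_sort.
Qed.

Lemma size_spectrum (R : realType) (G : sgraph) :
  size (spectrum R G) = #|vertex G|.
Proof.
have [_ Es] := spectrumP R G.
have := size_char_poly (laplacian_mx R G).
by rewrite Es size_prod_XsubC => -[].
Qed.

Definition spectral_measure (R : realType) (G : sgraph) :
    {measure set (measurableTypeR R) -> \bar R} :=
  mscale (#|vertex G|%:R^-1)%:nng
    (msum (fun i => \d_((spectrum R G)`_i : measurableTypeR R)) #|vertex G|).

(* A Radon measure on the Borel set X is encoded as its extension by 0 to the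
   whole line. *)
Definition radon_on (R : realType) (X : set R)
    (rho : {measure set (measurableTypeR R) -> \bar R}) : Prop :=
  [/\ rho (~` X) = 0%E,
      forall K : set R, compact K -> (rho K < +oo)%E &
      forall A : set (measurableTypeR R), measurable A ->
        rho A = ereal_sup [set rho K | K in [set K : set R |
                                              compact K /\ K `<=` A]]].

Definition in_spectral_class (R : realType) (G : nat -> sgraph)
    (rho : {measure set (measurableTypeR R) -> \bar R}) : Prop :=
  radon_on `[0, 2] rho /\
  forall f : R -> R, {within `[0, 2], continuous f} ->
    (\int[spectral_measure R (G n)]_(x in `[0%R, 2%R]) (f x)%:E)%E
      @[n --> \oo] --> (\int[rho]_(x in `[0%R, 2%R]) (f x)%:E)%E.

Section PathCycle.
Variable n : nat.

Definition path_adj : rel 'I_n :=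
  fun i j => (j == i.+1 :> nat) || (i == j.+1 :> nat).

Lemma path_adj_sym : symmetric path_adj.
Proof. by move=> i j; rewrite /path_adj /= orbC. Qed.

Lemma path_adj_irr : irreflexive path_adj.
Proof. by move=> i; rewrite /path_adj /= orbb ltn_eqF. Qed.

Definition path_graph : sgraph := SGraph path_adj_sym path_adj_irr.

(* The condition i != j only matters for n = 1. For n < 3, where there is no
   simple cycle on n nodes, this is the path; a finite number of terms is
   irrelevant for limits. *)
Definition cycle_adj : rel 'I_n :=
  fun i j => (i != j) && ((j == i.+1 %[mod n]) || (i == j.+1 %[mod n])).

Lemma cycle_adj_sym : symmetric cycle_adj.
Proof. by move=> i j; rewrite /cycle_adj /= eq_sym orbC. Qed.

Lemma cycle_adj_irr : irreflexive cycle_adj.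
Proof. by move=> i; rewrite /cycle_adj /= eqxx. Qed.

Definition cycle_graph : sgraph := SGraph cycle_adj_sym cycle_adj_irr.

End PathCycle.

(* Equal to 0 at the endpoints 0 and 2, where the formula is undefined. *)
Definition limit_density (R : realType) (x : R) : R :=
  1 / pi * (1 / Num.sqrt (2 * x - x ^+ 2)).

(* Main.v *)
Require Import Defs.
From HB Require Import structures.
From mathcomp Require Import all_boot all_order all_algebra.
From mathcomp Require Import all_classical all_reals all_analysis.
From mathcomp Require Import measurable_realfun ring lra zify.
Import Order.TTheory GRing.Theory Num.Theory.
Import numFieldNormedType.Exports.

Set Implicit Arguments.
Unset Strict Implicit.
Unset Printing Implicit Defensive.

Local Open Scope classical_set_scope.
Local Open Scope ring_scope.

(** The eigenvalues of the normalized Laplacian are explicit. On the path with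
    [N] nodes, the functions [y |-> cos (pi k y / (N - 1))], for [k < N], are
    eigenfunctions with the distinct eigenvalues [1 - cos (pi k / (N - 1))]
    ([char_poly_path]). On the cycle, the functions
    [y |-> cos (2 pi k y / N) + sin (2 pi k y / N)] are pairwise orthogonal
    eigenfunctions with eigenvalues [1 - cos (2 pi k / N)]
    ([char_poly_cycle]). In both cases the eigenvalues are, up to boundary
    terms, values of [arcpoint t = 1 - cos (pi t)] at equidistant [t] in the
    unit interval; on the cycle this interval is run through twice.

    The candidate limit is the measure with density [limit_density]. As
    [acos (1 - x) / pi] is a primitive of the density, the arc between
    [arcpoint s] and [arcpoint t] has measure [t - s] ([arcsine_arc]): the
    limit is the law of [arcpoint] at a uniformly distributed parameter.

    Therefore the mean of a continuous [f] over the spectrum is, up to a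
    vanishing error, a Riemann sum of the integral of [f] against the limit:
    cutting the interval at equidistant parameters gives arcs of equal measure
    on which [f] is nearly constant, by uniform continuity
    ([Riemann_arc_cvg]). This works directly with arcs, so no change of
    variables in an integral with an unbounded density takes place. Absence of
    atoms, absolute continuity and the Radon property follow from the
    existence of an integrable density. *)

(** * Spectra from eigenfunctions *)

Section Spectrum.
Context (R : realType) (G : sgraph).
Implicit Types v f : vertex G -> R.

Lemma laplacian_mxE v i :
  \sum_j laplacian_mx R G i j * v (enum_val j) = laplacian v (enum_val i).
Proof.
under eq_bigr do rewrite mxE /laplacian mulrBl.
rewrite sumrB; congr (_ - _).
  rewrite (bigD1 i)//= eqxx mul1r big1 ?addr0// => j ji.
  by rewrite (inj_eq enum_val_inj) eq_sym (negbTE ji) mul0r.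
rewrite mulr_sumr.
under eq_bigr do rewrite -mulrA mulr_suml.
under eq_bigr do rewrite mulr_sumr.
rewrite exchange_big/=; apply: eq_bigr => y _.
rewrite (bigD1 (enum_rank y))//= enum_rankK eqxx mul1r big1 ?addr0// => j jy.
case: eqVneq => [yj|]; last by rewrite mul0r mulr0.
by rewrite yj enum_valK eqxx in jy.
Qed.

Lemma laplacian_eigenvalue v z x : (forall y, laplacian v y = z * v y) ->
  v x != 0 -> root (char_poly (laplacian_mx R G)) z.
Proof.
move=> Lv vx.
have <- : char_poly (laplacian_mx R G)^T = char_poly (laplacian_mx R G).
  by rewrite /char_poly -[RHS]det_tr /char_poly_mx linearB/= tr_scalar_mx map_trmx.
rewrite -eigenvalue_root_char; apply/eigenvalueP; exists (\row_j v (enum_val j)).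
  apply/rowP => i; rewrite !mxE -Lv -laplacian_mxE.
  by apply: eq_bigr => j _; rewrite !mxE mulrC.
apply/eqP => /rowP/(_ (enum_rank x)); rewrite !mxE enum_rankK => /eqP.
by rewrite (negbTE vx).
Qed.

(** Pairwise distinct eigenvalues, as many as there are vertices, exhaust the
    roots of the characteristic polynomial; [x k] is a vertex witnessing that
    the eigenfunction [v k] is not zero. *)
Lemma char_poly_laplacian_distinct (z : vertex G -> R)
    (v : vertex G -> vertex G -> R) (x : vertex G -> vertex G) :
  injective z -> (forall k y, laplacian (v k) y = z k * v k y) ->
  (forall k, v k (x k) != 0) ->
  char_poly (laplacian_mx R G) = \prod_k ('X - (z k)%:P).
Proof.
move=> zI Lv v0.
rewrite (@all_roots_prod_XsubC _ (char_poly (laplacian_mx R G)) [seq z k | k : vertex G]).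
- by rewrite (monicP (char_poly_monic _)) scale1r big_image.
- by rewrite size_char_poly size_image.
- apply/allP => _ /mapP[k _ ->].
  exact: (laplacian_eigenvalue (Lv k) (v0 k)).
- by rewrite uniq_rootsE map_inj_uniq ?enum_uniq.
Qed.

(** With repeated eigenvalues multiplicities have to be controlled: orthogonal
    eigenfunctions of equal norm form an invertible matrix, which conjugates
    the Laplacian to a diagonal matrix. *)
Lemma char_poly_laplacian_orthogonal (z : vertex G -> R)
    (v : vertex G -> vertex G -> R) (c : R) : c != 0 ->
  (forall k y, laplacian (v k) y = z k * v k y) ->
  (forall k l, \sum_y v k y * v l y = (k == l)%:R * c) ->
  char_poly (laplacian_mx R G) = \prod_k ('X - (z k)%:P).
Proof.
move=> c0 Lv vv; set n := #|vertex G|.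
pose V : 'M[R]_n := \matrix_(i, k) v (enum_val k) (enum_val i).
pose D : 'M[R]_n := \matrix_(i, j) ((i == j)%:R * z (enum_val i)).
have LV : laplacian_mx R G *m V = V *m D.
  apply/matrixP => i k; rewrite !mxE.
  under eq_bigr do rewrite [V _ _]mxE.
  rewrite (laplacian_mxE (v (enum_val k))) Lv (bigD1 k)//= big1.
    by rewrite !mxE eqxx mul1r addr0 mulrC.
  by move=> j jk; rewrite !mxE (negbTE jk) mul0r mulr0.
have dV : \det V != 0.
  have : \det (V^T *m V) != 0.
    have -> : V^T *m V = c%:M.
      apply/matrixP => k l; rewrite !mxE.
      transitivity (\sum_y v (enum_val k) y * v (enum_val l) y).
        rewrite (reindex_onto (@enum_val (vertex G) predT) enum_rank) => [|i _];
          last exact: enum_rankK.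
        by apply: eq_big => [j|j _]; rewrite ?enum_valK ?eqxx// !mxE.
      by rewrite vv (inj_eq enum_val_inj) mulr_natl.
    by rewrite det_scalar expf_neq0.
  by rewrite det_mulmx det_tr mulf_eq0 orbb.
have E : char_poly_mx (laplacian_mx R G) *m map_mx polyC V =
         map_mx polyC V *m char_poly_mx D.
  by rewrite /char_poly_mx mulmxBl mulmxBr mul_scalar_mx mul_mx_scalar
             -!map_mxM LV.
transitivity (char_poly D).
  apply: (@mulIf _ (\det (map_mx polyC V))).
    by rewrite det_map_mx polyC_eq0.
  by rewrite /char_poly -det_mulmx E det_mulmx mulrC.
rewrite char_poly_trig; last first.
  by apply/is_trig_mxP => i j ij; rewrite mxE -val_eqE ltn_eqF ?mul0r.
rewrite [RHS](reindex_onto (@enum_val (vertex G) predT) enum_rank) => [|i _];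
  last exact: enum_rankK.
by apply: eq_big => [j|j _]; rewrite ?enum_valK ?eqxx// !mxE eqxx mul1r.
Qed.

Lemma perm_spectrum (z : vertex G -> R) :
  char_poly (laplacian_mx R G) = \prod_k ('X - (z k)%:P) ->
  perm_eq (spectrum R G) [seq z k | k : vertex G].
Proof.
move=> E; have [_ Es] := spectrumP R G.
by apply: prod_XsubC_eq; rewrite -Es E big_image.
Qed.

Lemma sum_spectrum (z : vertex G -> R) (f : R -> R) :
  char_poly (laplacian_mx R G) = \prod_k ('X - (z k)%:P) ->
  \sum_(i < #|vertex G|) f (spectrum R G)`_i = \sum_k f (z k).
Proof.
move=> /perm_spectrum P.
rewrite -(big_mkord predT (fun i => f (spectrum R G)`_i)) -(size_spectrum R G).
rewrite -(big_nth 0 predT f) (perm_big _ P) big_image.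
by apply: eq_bigl.
Qed.

Lemma mem_spectrum (z : vertex G -> R) (i : nat) :
  char_poly (laplacian_mx R G) = \prod_k ('X - (z k)%:P) ->
  (i < #|vertex G|)%N -> exists k, (spectrum R G)`_i = z k.
Proof.
move=> /perm_spectrum P; rewrite -(size_spectrum R G) => /(mem_nth 0).
by rewrite (perm_mem P) => /mapP[k _ ->]; exists k.
Qed.
End Spectrum.

Lemma degreeE (R : realType) (G : sgraph) (x : vertex G) :
  (degree x)%:R = \sum_(y | adj G x y) 1 :> R.
Proof. by rewrite /degree -sum1_card natr_sum. Qed.

Lemma laplacian_eq (R : realType) (G : sgraph) (v : vertex G -> R) x c :
  (degree x)%:R != 0 :> R ->
  \sum_(y | adj G x y) v y = (degree x)%:R * c * v x ->
  laplacian v x = (1 - c) * v x.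
Proof.
by move=> d0 E; rewrite /laplacian E !mulrA mulVf// mul1r mulrBl mul1r.
Qed.

(** * Trigonometric sums *)

Section Trig.
Context {R : realType}.

Lemma cosD_cosB (a b : R) : cos (a + b) + cos (a - b) = 2 * cos b * cos a.
Proof. by rewrite cosD cosB; ring. Qed.

Lemma sinD_sinB (a b : R) : sin (a + b) + sin (a - b) = 2 * cos b * sin a.
Proof. by rewrite sinD sinB; ring. Qed.

Lemma sin_mulpi k : sin (pi * k%:R) = 0 :> R.
Proof.
elim: k => [|k IH]; first by rewrite mulr0 sin0.
by rewrite -natr1 mulrDr mulr1 sinDpi IH oppr0.
Qed.

Lemma cos_add2pi (a : R) k : cos (a + pi *+ 2 * k%:R) = cos a.
Proof. by rewrite mulr_natr (periodicn (@cosD2pi R)). Qed.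

Lemma sin_add2pi (a : R) k : sin (a + pi *+ 2 * k%:R) = sin a.
Proof. by rewrite mulr_natr (periodicn (@sinD2pi R)). Qed.

Lemma sum_rotate n (F : nat -> R) : F n = F 0%N ->
  \sum_(j < n) F j.+1 = \sum_(j < n) F j.
Proof.
move=> Fn; apply: (addrI (F 0%N)); rewrite -(big_ord_recl n (fun j => F (val j))).
by rewrite big_ord_recr/= Fn addrC.
Qed.

(** The rotation by the angle [x] permutes the points at the multiples of [x],
    hence fixes their sum, and a rotation other than the identity fixes only
    the origin. *)
Lemma sum_cos_sin0 n (x : R) : cos (x * n%:R) = 1 -> sin (x * n%:R) = 0 ->
  cos x != 1 ->
  \sum_(j < n) cos (x * j%:R) = 0 /\ \sum_(j < n) sin (x * j%:R) = 0.
Proof.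
move=> cn sn cx.
set C := \sum_(j < n) cos _; set S := \sum_(j < n) sin _.
have EC : C * cos x - S * sin x = C.
  rewrite -[RHS](sum_rotate (F := fun j => cos (x * j%:R))) ?cn ?mulr0 ?cos0//.
  rewrite !mulr_suml -sumrB; apply: eq_bigr => j _.
  by rewrite -natr1 mulrDr mulr1 cosD.
have ES : S * cos x + C * sin x = S.
  rewrite -[RHS](sum_rotate (F := fun j => sin (x * j%:R))) ?sn ?mulr0 ?sin0//.
  rewrite !mulr_suml -big_split/=; apply: eq_bigr => j _.
  by rewrite -natr1 mulrDr mulr1 sinD.
have D : (1 - cos x) * 2 != 0 by rewrite mulf_neq0// subr_eq0 eq_sym.
have cs := cos2Dsin2 x.
(* Cramer's rule: the determinant of [EC] and [ES], as a linear system in [C]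
   and [S], is [(cos x - 1) ^+ 2 + sin x ^+ 2 = (1 - cos x) * 2]. *)
split; apply: (mulfI D); rewrite mulr0.
  have : (C * cos x - S * sin x - C) * (cos x - 1) +
      (S * cos x + C * sin x - S) * sin x = 0 by rewrite EC ES !subrr !mul0r addr0.
  move=> <-; transitivity (C * (1 + 1 - 2 * cos x)); first by ring.
  by rewrite -{2}cs; ring.
have : (S * cos x + C * sin x - S) * (cos x - 1) -
    (C * cos x - S * sin x - C) * sin x = 0 by rewrite EC ES !subrr !mul0r subr0.
move=> <-; transitivity (S * (1 + 1 - 2 * cos x)); first by ring.
by rewrite -{2}cs; ring.
Qed.

Lemma sum_sin0 n (x : R) : cos (x * n%:R) = 1 -> sin (x * n%:R) = 0 ->
  \sum_(j < n) sin (x * j%:R) = 0.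
Proof.
move=> cn sn; have [cx|cx] := eqVneq (cos x) 1; last first.
  by case: (sum_cos_sin0 cn sn cx).
have sx : sin x = 0 by apply: cos1sin0; rewrite cx normr1.
rewrite big1// => -[j /= _] _; elim: j => [|j IH]; first by rewrite mulr0 sin0.
by rewrite -natr1 mulrDr mulr1 sinD sx cx IH mul0r mulr0 addr0.
Qed.

Lemma cos_neq1 (x : R) : 0 < x < pi *+ 2 -> cos x != 1.
Proof.
move=> /andP[x0 x2].
have s0 : 0 < sin (x / 2).
  by apply: sin_gt0_pi; rewrite divr_gt0//= ltr_pdivrMr// mulr_natr.
rewrite (splitr x) -mulr2n cos_mulr2n cos2sin2; apply/eqP => E.
have : sin (x / 2) ^+ 2 = 0 by rewrite mulr2n in E; lra.
by apply/eqP; rewrite expf_neq0// gt_eqF.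
Qed.

Lemma sum_delta n k (F : nat -> R) :
  \sum_(y < n) (y == k :> nat)%:R * F y = (k < n)%N%:R * F k.
Proof.
case: ltnP => [kn|nk]; last first.
  rewrite mul0r big1// => y _; rewrite ltn_eqF ?mul0r//.
  exact: leq_trans (ltn_ord y) nk.
rewrite (bigD1 (Ordinal kn))//= eqxx big1 ?addr0// => y.
by rewrite -val_eqE/= => /negbTE ->; rewrite mul0r.
Qed.
End Trig.

(** * The spectra of paths and cycles *)

Section Path.
Context (R : realType) (n : nat).
Implicit Types (F : nat -> R) (x : 'I_n.+2).

Lemma path_neighbours x F : \sum_(y | path_adj x y) F y =
  (x.+1 < n.+2)%N%:R * F x.+1 + (0 < x)%N%:R * F x.-1.
Proof.
transitivity (\sum_(y < n.+2) ((y == x.+1 :> nat)%:R * F y +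
    (0 < x)%N%:R * ((y == x.-1 :> nat)%:R * F y))).
  rewrite big_mkcond/=; apply: eq_bigr => y _; rewrite /path_adj.
  have -> : (x == y.+1 :> nat) = (0 < x)%N && (y == x.-1 :> nat) by lia.
  case: ltnP => x0; case: eqVneq => yx; case: eqVneq => yx' /=;
    rewrite ?mul1r ?mul0r ?addr0 ?add0r //; lia.
rewrite big_split/= -mulr_sumr !sum_delta; congr (_ + _ * _).
by rewrite (leq_ltn_trans (leq_pred _) (ltn_ord x)) mul1r.
Qed.

Let angle k : R := pi * k%:R / n.+1%:R.

(** In the interior this is the addition formula for [cos]. The endpoint 0 has
    a single neighbour and works because [cos] is even; the endpoint [n.+1]
    works because [angle k * n.+1%:R] is a multiple of [pi], about which [cos]
    is even too. *)
Lemma laplacian_path_cos k (x : vertex (path_graph n.+2)) :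
  laplacian (fun y : vertex (path_graph n.+2) => cos (angle k * y%:R)) x =
  (1 - cos (angle k)) * cos (angle k * x%:R).
Proof.
set t := angle k.
have tn : sin (t * n.+1%:R) = 0 by rewrite divfK ?sin_mulpi// pnatr_eq0.
have xn := ltn_ord x.
apply: laplacian_eq.
  rewrite (degreeE R) (path_neighbours x (fun=> 1)) !mulr1 -natrD pnatr_eq0; lia.
rewrite (degreeE R) (path_neighbours x (fun=> 1)).
rewrite (path_neighbours x (fun y => cos (t * y%:R))) !mulr1.
have [x1|x1] := ltnP x.+1 n.+2; have [x0|x0] := ltnP 0 x; last by lia.
- rewrite !mul1r -(natrD _ 1 1) -cosD_cosB; congr (cos _ + cos _).
    by rewrite -natr1; ring.
  by rewrite -{2}(prednK x0) -natr1; ring.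
- have -> : x = 0%N :> nat by lia.
  by rewrite mulr1n mulr0n mulr0 cos0 (_ : t * 0.+1%:R = t); ring.
- have -> : x = n.+1 :> nat by lia.
  rewrite mul0r !add0r !mul1r /=.
  have -> : t * n%:R = t * n.+1%:R - t by rewrite -natr1; ring.
  by rewrite cosB tn mul0r addr0 mulrC.
Qed.

Lemma char_poly_path : char_poly (laplacian_mx R (path_graph n.+2)) =
  \prod_(k < n.+2) ('X - (1 - cos (angle k))%:P).
Proof.
apply: (@char_poly_laplacian_distinct R (path_graph n.+2)
  (fun k : 'I_n.+2 => 1 - cos (angle k)) _ (fun=> ord0)).
- move=> k l /(addrI 1)/oppr_inj/cos_inj.
  have ang (j : 'I_n.+2) : angle j \in `[0, pi].
    rewrite in_itv/= divr_ge0 ?mulr_ge0 ?pi_ge0//=.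
    rewrite ler_pdivrMr ?ltr0n// ler_pM2l ?pi_gt0// ler_nat.
    by have := ltn_ord j; lia.
  move=> /(_ (ang k) (ang l)) /(mulIf _)-/(_ _)/wrap[|].
    by rewrite invr_eq0 pnatr_eq0.
  move=> /(mulfI _)-/(_ _)/wrap[|].
    by rewrite gt_eqF ?pi_gt0.
  by move=> /eqP; rewrite eqr_nat => /eqP/val_inj.
- by move=> k y; exact: laplacian_path_cos.
- by move=> k /=; rewrite mulr0 cos0 oner_neq0.
Qed.
End Path.

Section Cycle.
Context (R : realType) (n : nat).
Implicit Types (F : nat -> R) (x : 'I_n.+3).

(** Having at least three vertices makes the neighbours [x + 1] and [x - 1]
    distinct, so that their contributions do not merge. *)
Lemma cycle_neighbours x F : \sum_(y | cycle_adj x y) F y =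
  F (x.+1 %% n.+3)%N + F ((x + n.+2) %% n.+3)%N.
Proof.
transitivity (\sum_(y < n.+3) ((y == (x.+1 %% n.+3)%N :> nat)%:R * F y +
    (y == ((x + n.+2) %% n.+3)%N :> nat)%:R * F y)).
  rewrite big_mkcond/=; apply: eq_bigr => y _; rewrite /cycle_adj -val_eqE/=.
  have xn := ltn_ord x; have yn := ltn_ord y.
  have mS z : (z < n.+3)%N ->
      (z.+1 %% n.+3)%N = if z == n.+2 then 0%N else z.+1.
    by move=> zn; case: eqVneq => [->|z2]; rewrite ?modnn// modn_small; lia.
  have mP : ((x + n.+2) %% n.+3)%N = if x == 0%N :> nat then n.+2 else x.-1.
    case: eqVneq => [->|x0]; first by rewrite modn_small; lia.
    have -> : (x + n.+2 = x.-1 + n.+3)%N by lia.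
    by rewrite modnDr modn_small; lia.
  rewrite !mS// mP (modn_small xn) (modn_small yn).
  rewrite -mulrDl -natrD; case: ifP => [c|c].
    rewrite [X in X%:R](_ : _ = 1%N) ?mul1r//; move: c.
    by case: ifP; case: ifP; case: ifP; lia.
  rewrite [X in X%:R](_ : _ = 0%N) ?mul0r//; move: c.
  by case: ifP; case: ifP; case: ifP; lia.
by rewrite big_split/= !sum_delta !ltn_pmod// !mul1r.
Qed.

Let angle k : R := pi *+ 2 * k%:R / n.+3%:R.

(** Real and still able to separate the two eigenfunctions of each double
    eigenvalue, unlike [cos] or [sin] alone: this is the kernel of the
    Hartley transform, the real counterpart of the discrete Fourier one. *)
Let cas (x : R) : R := cos x + sin x.

Let casE k j : cas (angle k * (j %% n.+3)%:R) = cas (angle k * j%:R).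
Proof.
rewrite [in RHS](divn_eq j n.+3) natrD natrM mulrDr addrC.
have -> : angle k * ((j %/ n.+3)%:R * n.+3%:R) = pi *+ 2 * (k * (j %/ n.+3))%:R.
  have : n.+3%:R != 0 :> R by rewrite pnatr_eq0.
  by rewrite natrM /angle; move: n.+3%:R => N N0; field.
by rewrite /cas cos_add2pi sin_add2pi.
Qed.

Lemma laplacian_cycle_cas k (x : vertex (cycle_graph n.+3)) :
  laplacian (fun y : vertex (cycle_graph n.+3) => cas (angle k * y%:R)) x =
  (1 - cos (angle k)) * cas (angle k * x%:R).
Proof.
apply: laplacian_eq.
  by rewrite (degreeE R) (cycle_neighbours x (fun=> 1)) -(natrD _ 1 1) pnatr_eq0.
rewrite (degreeE R) (cycle_neighbours x (fun=> 1)).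
rewrite (cycle_neighbours x (fun y => cas (angle k * y%:R))) !casE.
set t := angle k; rewrite -natr1.
have -> : t * (x + n.+2)%:R = (t * x%:R - t) + pi *+ 2 * k%:R.
  have : n.+3%:R != 0 :> R by rewrite pnatr_eq0.
  rewrite natrD /t /angle -natr1; move: n.+2%:R => N N0.
  by field.
rewrite /cas cos_add2pi sin_add2pi mulrDr mulr1 addrACA cosD_cosB sinD_sinB.
by rewrite -(natrD _ 1 1); ring.
Qed.

(** Orthogonality follows from [cas a * cas b = cos (a - b) + sin (a + b)] and
    the vanishing of the trigonometric sums over full periods. *)
Lemma char_poly_cycle : char_poly (laplacian_mx R (cycle_graph n.+3)) =
  \prod_(k < n.+3) ('X - (1 - cos (angle k))%:P).
Proof.
apply: (@char_poly_laplacian_orthogonal R (cycle_graph n.+3)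
  (fun k : 'I_n.+3 => 1 - cos (angle k))
  (fun k y : 'I_n.+3 => cas (angle k * y%:R)) n.+3%:R).
- by rewrite pnatr_eq0.
- by move=> k y; exact: laplacian_cycle_cas.
move=> /= k l.
have aN j : angle j * n.+3%:R = pi *+ 2 * j%:R.
  by rewrite /angle divfK// pnatr_eq0.
have c1 (j : nat) : cos (pi *+ 2 * j%:R) = 1 :> R.
  by rewrite -(add0r (_ * _)) cos_add2pi cos0.
have s0 (j : nat) : sin (pi *+ 2 * j%:R) = 0 :> R.
  by rewrite -(add0r (_ * _)) sin_add2pi sin0.
transitivity (\sum_(y < n.+3) cos ((angle k - angle l) * y%:R) +
              \sum_(y < n.+3) sin ((angle k + angle l) * y%:R)).
  rewrite -big_split/=; apply: eq_bigr => y _.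
  by rewrite mulrBl (mulrDl (angle k)) /cas cosB sinD; ring.
rewrite [X in _ + X]sum_sin0 ?addr0; last 2 first.
- by rewrite mulrDl !aN cosD !s0 !c1 mul0r mulr1 subr0.
- by rewrite mulrDl !aN sinD !s0 mul0r mulr0 addr0.
case: eqVneq => [->|kl].
  rewrite subrr; under eq_bigr do rewrite mul0r cos0.
  by rewrite sumr_const card_ord mul1r.
rewrite mul0r.
have [] // := @sum_cos_sin0 R n.+3 (angle k - angle l).
- by rewrite mulrBl !aN cosB !s0 !c1 mul0r mulr1 addr0.
- by rewrite mulrBl !aN sinB !s0 mul0r mulr0 subr0.
wlog lk : k l kl / (l < k)%N.
  move=> W; have /orP[lk|lk] : (l < k)%N || (k < l)%N.
  - by rewrite -neq_ltn eq_sym.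
  - exact: W.
  - by rewrite -opprB cosN; apply: W; rewrite // eq_sym.
apply: cos_neq1; rewrite /angle -mulrBl -mulrBr -natrB ?(ltnW lk)//.
have p0 : 0 < pi *+ 2 :> R by rewrite mulrn_wgt0// pi_gt0.
rewrite divr_gt0 ?mulr_gt0 ?ltr0n ?subn_gt0//=.
rewrite ltr_pdivrMr ?ltr0n// (ltr_pM2l p0) ltr_nat.
by have := ltn_ord k; lia.
Qed.
End Cycle.

(** * The arcsine measure *)

Section Density.
Context {R : realType}.
Notation leb := (@lebesgue_measure R).

Lemma limit_density_ge0 (x : R) : 0 <= limit_density x.
Proof. by rewrite /limit_density mulr_ge0 ?divr_ge0 ?pi_ge0 ?sqrtr_ge0. Qed.

(** The square root of a nonpositive number is 0, and so is the inverse of 0;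
    hence integrating the density over any Borel set only sees the part of
    that set inside the interval. *)
Lemma limit_density_out (x : R) : ~~ (0 < x < 2) -> limit_density x = 0.
Proof.
move=> x02; rewrite /limit_density ler0_sqrtr ?invr0 ?mulr0//.
have -> : 2 * x - x ^+ 2 = x * (2 - x) by ring.
by move: x02; rewrite negb_and -!leNgt => /orP[x0|x2]; nra.
Qed.

Lemma continuous_limit_density (x : R) : 0 < x < 2 ->
  {for x, continuous (@limit_density R)}.
Proof.
move=> x02.
have r0 : 0 < 2 * x - x ^+ 2 by case/andP: x02 => x0 x2; nra.
apply: cvgM; first exact: cvg_cst.
apply: cvgM; first exact: cvg_cst.
apply: cvgV; first by rewrite gt_eqF// sqrtr_gt0.
apply: continuous_comp; last exact: sqrt_continuous.
apply: cvgB; last exact: exprn_continuous.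
by apply: cvgM; [exact: cvg_cst|exact: cvg_id].
Qed.

Lemma measurable_limit_density : measurable_fun setT (@limit_density R).
Proof.
rewrite (_ : @limit_density R = @limit_density R \_ `]0%R, 2%R[); last first.
  apply/funext => x; rewrite patchE; case: ifPn => //.
  rewrite notin_setE/= in_itv/= => /negP; exact: limit_density_out.
apply: (iffLR (measurable_restrictT _ _)) => //.
apply: measurable_realfun.open_continuous_measurable_fun.
  exact: interval_open.
by move=> x /set_mem/=; rewrite in_itv/=; exact: continuous_limit_density.
Qed.

Definition arcsine_measure (U : set (measurableTypeR R)) : \bar R :=
  (\int[leb]_(x in U) (limit_density x)%:E)%E.

Let arcsine0 : arcsine_measure set0 = 0%E.
Proof. by rewrite /arcsine_measure integral_set0. Qed.

Let arcsine_ge0 U : (0 <= arcsine_measure U)%E.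
Proof. by apply: integral_ge0 => x _; rewrite lee_fin limit_density_ge0. Qed.

Let arcsine_sigma_additive : semi_sigma_additive arcsine_measure.
Proof.
move=> /= F mF tF mUF; rewrite /arcsine_measure; apply: cvg_toP.
  apply: ereal_nondecreasing_is_cvgn => m n mn.
  by apply: lee_sum_nneg_natr => // k _ _; exact: arcsine_ge0.
rewrite ge0_integral_bigcup//=.
  by apply/measurable_EFinP/measurable_funTS; exact: measurable_limit_density.
by move=> x _; rewrite lee_fin limit_density_ge0.
Qed.

HB.instance Definition _ := isMeasure.Build _ _ _ arcsine_measure
  arcsine0 arcsine_ge0 arcsine_sigma_additive.

Lemma arcsine_dominated A : measurable A -> leb A = 0%E -> arcsine_measure A = 0%E.
Proof.
move=> mA A0; apply: null_set_integral => //.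
by apply/measurable_EFinP/measurable_funTS; exact: measurable_limit_density.
Qed.

Lemma arcsine_set1 (x : R) : arcsine_measure [set x] = 0%E.
Proof. by apply: arcsine_dominated => //; exact: lebesgue_measure_set1. Qed.

(** Parametrizes the interval by the half circle above it, with the angle
    rescaled to the unit interval; the arcsine measure is the image of the
    uniform measure under it. *)
Definition arcpoint (t : R) : R := 1 - cos (pi * t).

Lemma in_itv0pi (t : R) : 0 <= t <= 1 -> pi * t \in `[0, pi].
Proof. by move=> ?; rewrite in_itv/=; have := pi_gt0 R; nra. Qed.

Lemma ltr_arcpoint (s t : R) : 0 <= s <= 1 -> 0 <= t <= 1 ->
  (arcpoint s < arcpoint t) = (s < t).
Proof.
move=> s01 t01; rewrite /arcpoint ltrD2l ltrN2 ltr_cos ?in_itv0pi//.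
by rewrite ltr_pM2l// pi_gt0.
Qed.

Lemma arcpoint02 (t : R) : 0 <= arcpoint t <= 2.
Proof.
by rewrite /arcpoint; have := cos_le1 (pi * t); have := cos_geN1 (pi * t); lra.
Qed.

Lemma arcpoint0 : arcpoint 0 = 0.
Proof. by rewrite /arcpoint mulr0 cos0 subrr. Qed.

Lemma arcpoint1 : arcpoint 1 = 2.
Proof. by rewrite /arcpoint mulr1 cospi opprK. Qed.

Lemma arcpointK (t : R) : 0 <= t <= 1 -> acos (1 - arcpoint t) = pi * t.
Proof. by move=> t01; rewrite /arcpoint opprB addrC subrK cosK// in_itv0pi. Qed.

Lemma arcpoint_surj (x : R) : 0 <= x <= 2 -> exists2 t, 0 <= t <= 1 & x = arcpoint t.
Proof.
move=> x02; have x11 : -1 <= 1 - x <= 1 by lra.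
exists (acos (1 - x) / pi).
  by rewrite divr_ge0 ?acos_ge0 ?pi_ge0//= ler_pdivrMr ?pi_gt0// mul1r acos_lepi.
rewrite /arcpoint mulrC divfK ?gt_eqF ?pi_gt0// acosK ?in_itv//=.
by rewrite opprB addrC subrK.
Qed.

(** The density is the derivative of [acos (1 - x) / pi], which is the inverse
    of [arcpoint]. The arc stays away from the endpoints, where the density is
    unbounded. *)
Lemma arcsine_arc_interior (s t : R) : 0 < s -> s < t -> t < 1 ->
  arcsine_measure `[arcpoint s, arcpoint t] = (t - s)%:E.
Proof.
move=> s0 st t1.
have as0 : 0 < arcpoint s by rewrite -arcpoint0 ltr_arcpoint; lra.
have at2 : arcpoint t < 2 by rewrite -arcpoint1 ltr_arcpoint; lra.
pose F (x : R) : R := pi^-1 * acos (1 - x).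
have dF (x : R) : 0 < x < 2 -> is_derive x 1 F (limit_density x).
  move=> x02; have x11 : -1 < 1 - x < 1 by lra.
  have dB : is_derive x 1 (fun y : R => 1 - y) (-1).
    by apply: (is_derive_eq (is_deriveB _ _)); rewrite sub0r.
  have dacos := @is_derive1_comp R acos (fun y => 1 - y) x _ _ (is_derive1_acos x11) dB.
  apply: (is_derive_eq (is_deriveZ _ dacos)).
  rewrite mulrN1 opprK /limit_density !mul1r [_ *: _]/(_ * _).
  by congr (_ * (Num.sqrt _)^-1); ring.
have cF (x : R) : 0 < x < 2 -> {for x, continuous F}.
  move=> /dF dFx; apply: differentiable_continuous; apply/derivable1_diffP.
  exact: ex_derive.
have in02 (x : R) : arcpoint s <= x <= arcpoint t -> 0 < x < 2 by lra.
have ltst : arcpoint s < arcpoint t by rewrite ltr_arcpoint; lra.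
rewrite /arcsine_measure (@continuous_FTC2 _ _ F) => //.
- by rewrite /F !arcpointK ?mulKf ?gt_eqF ?pi_gt0//; lra.
- apply: continuous_in_subspaceT => x /set_mem/=; rewrite in_itv/= => /in02.
  exact: continuous_limit_density.
- split.
  + move=> x; rewrite in_itv/= => /andP[sx xt].
    by apply: ex_derive; apply: dF; apply: in02; rewrite !ltW.
  + by apply: cvg_at_right_filter; apply: cF; apply: in02; lra.
  + by apply: cvg_at_left_filter; apply: cF; apply: in02; lra.
- move=> x; rewrite in_itv/= => /andP[sx xt].
  by rewrite derive1E; apply: derive_val; apply: dF; apply: in02; rewrite !ltW.
Qed.

Lemma arcsine_setU1 (A : set (measurableTypeR R)) (x : R) : measurable A ->
  arcsine_measure (A `|` [set x]) = arcsine_measure A.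
Proof.
move=> mA; apply: (iffLR (null_setU _ _)) => //.
by apply/measure0_null_setP => //; exact: arcsine_set1.
Qed.

(** The open arc is an increasing union of closed arcs that stay away from the
    singular endpoints 0 and 2. *)
Lemma arcsine_open_arc (s t : R) : 0 <= s -> s < t -> t <= 1 ->
  arcsine_measure `]arcpoint s, arcpoint t[ = (t - s)%:E.
Proof.
move=> s0 st t1.
(* Dividing by at least 3 keeps the shrunken arcs nonempty. *)
pose d n : R := (t - s) / n.+3%:R.
have d0 n : 0 < d n by rewrite divr_gt0// subr_gt0.
have d2 n : d n * 2 < t - s.
  by rewrite /d mulrAC ltr_pdivrMr// ltr_pM2l ?subr_gt0// ltr_nat.
have dle m n : (m <= n)%N -> d n <= d m.
  by move=> mn; rewrite ler_pM2l ?subr_gt0// lef_pV2 ?posrE// ler_nat.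
have dcvg : d n @[n --> \oo] --> 0.
  rewrite -(mulr0 (t - s)); apply: cvgM; first exact: cvg_cst.
  under eq_fun do rewrite -addn2.
  exact: cvg_comp (cvg_addnr 2) cvg_harmonic.
pose F n : set (measurableTypeR R) := `[arcpoint (s + d n), arcpoint (t - d n)]%classic.
have FE : \bigcup_n F n = `]arcpoint s, arcpoint t[%classic.
  apply/seteqP; split => x /=.
    move=> [n _]; rewrite /F/= !in_itv/= => /andP[sx xt].
    have := d0 n; have := d2 n => dn dn0.
    rewrite (lt_le_trans _ sx) ?(le_lt_trans xt)// ltr_arcpoint; lra.
  rewrite in_itv/= => /andP[sx xt].
  have [|u u01 xu] := @arcpoint_surj x.
    by have := arcpoint02 s; have := arcpoint02 t; lra.
  move: sx xt; rewrite {}xu !ltr_arcpoint; [|lra..] => su ut.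
  have [n] : exists n, d n < Num.min (u - s) (t - u).
    have m0 : 0 < Num.min (u - s) (t - u) by rewrite lt_min !subr_gt0 su.
    have [N _ /(_ N (leqnn _))] := cvgr_lt 0 dcvg _ m0.
    by exists N.
  rewrite lt_min => /andP[dsu dtu]; exists n => //; rewrite /F/=.
  rewrite in_itv/= !leNgt !ltr_arcpoint -?leNgt; have := d0 n; lra.
have : (arcsine_measure \o F) n @[n --> \oo] --> arcsine_measure (\bigcup_n F n).
  apply: nondecreasing_cvg_mu => //.
  - by move=> i; exact: measurable_itv.
  - by rewrite FE; exact: measurable_itv.
  - apply/nondecreasing_seqP => n; apply/subsetPset => x; rewrite /F/= !in_itv/=.
    have := dle _ _ (leqnSn n); have := d0 n.+1; have := d2 n => ddn dn dnn.
    move=> /andP[sx xt]; apply/andP; split; [apply: le_trans sx|apply: le_trans xt _];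
    rewrite leNgt ltr_arcpoint -?leNgt; lra.
rewrite FE => muF; apply: (cvg_unique (@ereal_hausdorff R) muF).
have -> : (arcsine_measure \o F) = (fun n => (t - s - d n * 2)%:E).
  apply/funext => n /=; have := d0 n; have := d2 n => dn dn0.
  by rewrite arcsine_arc_interior; [congr EFin; ring|lra..].
apply/cvg_EFin; first exact: nearW.
rewrite -[X in _ --> X]subr0 -[X in _ --> _ - X](mul0r 2).
by apply: cvgB; [exact: cvg_cst|apply: cvgM => //; exact: cvg_cst].
Qed.

Lemma arcsine_arc (s t : R) : 0 <= s -> s <= t -> t <= 1 ->
  arcsine_measure `]arcpoint s, arcpoint t] = (t - s)%:E.
Proof.
move=> s0; rewrite le_eqVlt => /predU1P[<- _|st t1].
  by rewrite set_itv_ge ?bnd_simp ?ltxx// measure0 subrr.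
rewrite -(@setUitv1 _ _ _ _ true) ?arcsine_setU1 ?arcsine_open_arc//.
by rewrite bnd_simp ltr_arcpoint; lra.
Qed.

Lemma arcsine_total : arcsine_measure `[0, 2] = 1%E.
Proof.
rewrite -(@setU1itv _ _ _ _ false) ?bnd_simp// setUC arcsine_setU1//.
by rewrite -{1}arcpoint0 -arcpoint1 arcsine_arc// subr0.
Qed.

Lemma arcsine_restrict (A : set (measurableTypeR R)) : measurable A ->
  arcsine_measure (A `&` `[0, 2]) = arcsine_measure A.
Proof.
move=> mA; rewrite /arcsine_measure integral_mkcondr; apply: eq_integral => x _.
rewrite patchE; case: ifPn => //; rewrite notin_setE/= in_itv/= => x02.
rewrite limit_density_out//; apply/negP => /andP[x0 x2].
by apply: x02; rewrite !ltW.
Qed.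

Lemma arcsine_setT : arcsine_measure setT = 1%E.
Proof. by rewrite -arcsine_restrict// setTI arcsine_total. Qed.

Lemma arcsine_fin (A : set (measurableTypeR R)) : measurable A ->
  (arcsine_measure A < +oo)%E.
Proof.
move=> mA; apply: (@le_lt_trans _ _ (arcsine_measure setT)).
  by apply: le_measure; rewrite ?inE.
by rewrite arcsine_setT ltry.
Qed.

(** Inner regularity is inherited from the Lebesgue measure: a compact subset
    of almost full Lebesgue measure has almost full arcsine measure, since the
    integral of an integrable function is absolutely continuous. *)
Lemma arcsine_radon : radon_on `[0, 2] arcsine_measure.
Proof.
split.
- have m02 : measurable (~` `[0%R, 2%R] : set (measurableTypeR R)).
    by apply: measurableC; exact: measurable_itv.
  by rewrite -[LHS](arcsine_restrict m02) setICl; exact: measure0.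
- move=> K cK; apply: arcsine_fin; apply: closed_measurable.
  by apply: compact_closed => //; exact: Rhausdorff.
move=> A mA; apply/eqP; rewrite eq_le; apply/andP; split; last first.
  apply: ge_ereal_sup => _ [K [cK KA] <-]; apply: le_measure => //; rewrite inE//.
  by apply: closed_measurable; apply: compact_closed => //; exact: Rhausdorff.
have idens : leb.-integrable setT (EFin \o @limit_density R).
  apply/integrableP; split.
    by apply/measurable_EFinP; exact: measurable_limit_density.
  rewrite (@le_lt_trans _ _ (arcsine_measure setT)) ?arcsine_setT ?ltry//.
  rewrite -arcsine_setT le_eqVlt; apply/orP; left; apply/eqP.
  by apply: eq_integral => x _ /=; rewrite ger0_norm// limit_density_ge0.
rewrite -[leLHS](arcsine_restrict mA); apply/lee_addgt0Pr => e e0.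
have [d [d0 dP]] := integral_normr_continuous idens e0.
have mA02 : measurable (A `&` `[0, 2] : set R) by exact: measurableI.
have [|K [cK KA AK]] := lebesgue_regularity_inner mA02 _ d0.
  apply: (@le_lt_trans _ _ (leb `[0, 2])).
    by apply: le_measure; rewrite ?inE//; exact: subIsetr.
  by rewrite lebesgue_measure_itv/= lte_fin ltr0n/= -EFinB ltry.
have mK : measurable K.
  by apply: closed_measurable; apply: compact_closed => //; exact: Rhausdorff.
rewrite -(setDKU KA) (le_trans (measureU2 _ _ _))//; first exact: measurableD.
rewrite addeC leeD//.
  apply: ereal_sup_ubound; exists K => //; split=> //.
  by apply: subset_trans KA _; exact: subIsetl.
have mAK := measurableD mA02 mK.
rewrite -[leLHS]fineK ?ge0_fin_numE ?measure_ge0 ?arcsine_fin// lee_fin.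
apply: le_trans (ltW (dP _ mAK AK)); rewrite le_eqVlt; apply/orP; left.
apply/eqP; congr fine; apply: eq_integral => x _ /=.
by rewrite ger0_norm// limit_density_ge0.
Qed.

End Density.

(** * Integration against spectral measures *)

Section SpectralIntegral.
Context {R : realType} (G : sgraph).

Let ge0_integral_spectral (f : R -> R) : measurable_fun (`[0, 2] : set R) f ->
  (forall x, 0 <= f x) ->
  (forall i, (i < #|vertex G|)%N -> 0 <= (spectrum R G)`_i <= 2) ->
  (\int[spectral_measure R G]_(x in `[0%R, 2%R]) (f x)%:E)%E =
  (#|vertex G|%:R^-1 * \sum_(i < #|vertex G|) f (spectrum R G)`_i)%:E.
Proof.
move=> mf f0 s02; rewrite /spectral_measure ge0_integral_mscale//=; last first.
- by move=> x _; rewrite lee_fin.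
- exact/measurable_EFinP.
rewrite ge0_integral_measure_sum//=; last 2 first.
- by move=> x _; rewrite lee_fin.
- exact/measurable_EFinP.
rewrite EFinM -sumEFin; congr (_ * _)%E; apply: eq_bigr => i _.
rewrite integral_dirac//=; last exact/measurable_EFinP.
by rewrite diracE mem_set ?mul1e//= in_itv/= s02.
Qed.

Lemma integral_spectral_measure (z : vertex G -> R) (f : R -> R) :
  char_poly (laplacian_mx R G) = \prod_k ('X - (z k)%:P) ->
  (forall k, 0 <= z k <= 2) -> measurable_fun (`[0, 2] : set R) f ->
  (\int[spectral_measure R G]_(x in `[0%R, 2%R]) (f x)%:E)%E =
  (#|vertex G|%:R^-1 * \sum_k f (z k))%:E.
Proof.
move=> E z02 mf.
have s02 i : (i < #|vertex G|)%N -> 0 <= (spectrum R G)`_i <= 2.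
  by move=> /(mem_spectrum E)[k ->].
rewrite integralE.
have -> : ((fun x => (f x)%:E)^\+)%E = (fun x => (Num.max (f x) 0)%:E).
  by apply/funext => x; rewrite funeposE EFin_max.
have -> : ((fun x => (f x)%:E)^\-)%E = (fun x => (Num.max (- f x) 0)%:E).
  by apply/funext => x; rewrite funenegE EFin_max EFinN.
rewrite !ge0_integral_spectral//; last 4 first.
- by apply: measurable_maxr => //; apply: measurableT_comp.
- by move=> x; rewrite le_max lexx orbT.
- by apply: measurable_maxr.
- by move=> x; rewrite le_max lexx orbT.
rewrite -EFinB -mulrBr -sumrB -(sum_spectrum f E); congr (_ * _)%:E.
apply: eq_bigr => i _; set y := f _.
by rewrite !maxElt; case: ifPn => ?; case: ifPn => ?; lra.
Qed.
End SpectralIntegral.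

(** * Riemann sums along arcs *)

(** Only the first point is confined to the segment. A neighbourhood of a point
    of the segment on which [h] varies little is uniform by compactness, in the
    form of near coverings. *)
Lemma segment_unif_continuous {R : realType} (h : R -> R) (a b e : R) :
  continuous h -> 0 < e -> exists2 d, 0 < d &
  forall x y, a <= x <= b -> `|x - y| < d -> `|h x - h y| < e.
Proof.
move=> ch e0.
have /compact_near_coveringP/(_ R (0^'+) (fun d x => forall y, `|x - y| < d ->
  `|h x - h y| < e)) cov := @segment_compact R a b.
have {cov} unif : \forall d \near 0^'+, `[a, b] `<=`
    (fun x => forall y, `|x - y| < d -> `|h x - h y| < e).
  apply: cov => x _.
  have /cvgrPdist_lt/(_ (e / 2))[|r /= r0 hr] := ch x; first by rewrite divr_gt0.
  exists (ball x (r / 2), [set d | d < r / 2]) => /=.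
    split; first by apply: nbhsx_ballx; rewrite divr_gt0.
    by apply: nbhs_right_lt; rewrite divr_gt0.
  move=> [x' d]/= [xx' dr] y x'y.
  have xr' : `|h x - h x'| < e / 2.
    by apply: hr => /=; rewrite (lt_trans xx')// gtr_pMr// invf_lt1// ltr1n.
  have xr : `|h x - h y| < e / 2.
    apply: hr => /=; rewrite (splitr r) -(subrK x' x) -addrA.
    by rewrite (le_lt_trans (ler_normD _ _))// ltrD// (lt_trans x'y).
  rewrite [ltRHS]splitr -(subrK (h x) (h x')) -addrA.
  by rewrite (le_lt_trans (ler_normD _ _))// ltrD// distrC.
have [d [d0 dP]] := filter_ex (filterI (nbhs_right_gt 0) unif).
by exists d => // x y xab; apply: dP; rewrite /= in_itv.
Qed.

Section Riemann.
Context {R : realType} (f : R -> R).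
Context (cf : {within `[0%R, 2%R], continuous f}).
Notation rho := (@arcsine_measure R : {measure set (measurableTypeR R) -> \bar R}).
Let h (t : R) := f (arcpoint t).

Lemma measurable_within02 : measurable_fun (`[0, 2] : set R) f.
Proof. by apply: subspace_continuous_measurable_fun. Qed.

(** As [arcpoint] maps the whole line into the interval, continuity of [f]
    within the interval becomes continuity on the line. *)
Lemma continuous_comp_arcpoint : continuous h.
Proof.
move=> t; have tI : `[0%R, 2%R]%classic (arcpoint t).
  by rewrite /= in_itv/= arcpoint02.
have /subspace_continuousP/(_ _ tI) cft := cf.
apply: cvg_comp cft => U UN.
have ca : {for t, continuous (@arcpoint R)}.
  apply: cvgB; first exact: cvg_cst.
  apply: continuous_comp; last exact: continuous_cos.
  by apply: cvgM; [exact: cvg_cst|exact: cvg_id].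
have := ca _ UN; rewrite !near_simpl /=; apply: filterS => u; apply.
by rewrite /= in_itv/= arcpoint02.
Qed.

Lemma comp_arcpoint_bounded : exists M, forall t, `|h t| <= M.
Proof.
have [|c] := @EVT_max R (fun t => `|h t|) 0 1 ler01.
  apply: continuous_subspaceT => t.
  by apply: cvg_norm; exact: continuous_comp_arcpoint.
move=> c01 hc; exists `|h c| => t.
have [u u01 tu] := arcpoint_surj (arcpoint02 t).
by rewrite /h tu hc// in_itv.
Qed.

Lemma integrable02 : rho.-integrable (`[0, 2] : set R) (EFin \o f).
Proof.
apply: measurable_bounded_integrable => //.
- exact: arcsine_fin.
- exact: measurable_within02.
have [M hM] := comp_arcpoint_bounded; exists M; split; first exact: num_real.
move=> x Mx y /=; rewrite in_itv/= => /arcpoint_surj[t _ ->].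
by rewrite (le_trans (hM t))// ltW.
Qed.

Lemma integrable_arc (s t : R) : rho.-integrable `]arcpoint s, arcpoint t] (EFin \o f).
Proof.
apply: integrableS integrable02 => // x/=; rewrite !in_itv/=.
have := arcpoint02 s; have := arcpoint02 t; lra.
Qed.

(** Arcs have arcsine measure equal to the length of their parameter interval,
    so this bounds the error of replacing [f] by a constant [c] there. *)
Lemma arc_estimate (s t c k : R) : 0 <= s -> s <= t -> t <= 1 ->
  (forall u, s <= u <= t -> `|h u - c| <= k) ->
  `|\int[rho]_(x in `]arcpoint s, arcpoint t]) f x - c * (t - s)| <= k * (t - s).
Proof.
move=> s0 st t1 hk; set A : set (measurableTypeR R) := `]_, _]%classic.
have mA : measurable A by exact: measurable_itv.
have rA : fine (rho A) = t - s by rewrite [rho A](arcsine_arc s0 st t1).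
have icst r : rho.-integrable A (EFin \o cst r).
  apply: measurable_bounded_integrable => //; first exact: arcsine_fin.
  exact: bounded_cst.
have ifc : rho.-integrable A (EFin \o (fun x => f x - c)).
  by apply: (integrableB _ (integrable_arc s t) (icst c)).
have cstE r : \int[rho]_(x in A) (cst r x) = r * (t - s).
  by rewrite Rintegral_cst//; congr (_ * _); exact: rA.
rewrite -(cstE c) -(cstE k).
rewrite -(RintegralB mA (integrable_arc s t) (icst c)).
apply: (le_trans (le_normr_Rintegral mA ifc)).
apply: le_Rintegral => //; first exact: (integrable_norm ifc).
move=> x; rewrite /A/= in_itv/= => /andP[sx xt].
have [|u u01 xu] := @arcpoint_surj _ x.
  by have := arcpoint02 s; have := arcpoint02 t; lra.
move: sx xt; rewrite xu leNgt !ltr_arcpoint; [|lra..] => su ut.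
by apply: hk; rewrite (ltW su) leNgt.
Qed.

Lemma Rintegral_arcD (s t u : R) : 0 <= s -> s <= t -> t <= u -> u <= 1 ->
  \int[rho]_(x in `]arcpoint s, arcpoint u]) f x =
  \int[rho]_(x in `]arcpoint s, arcpoint t]) f x +
  \int[rho]_(x in `]arcpoint t, arcpoint u]) f x.
Proof.
move=> s0 st tu u1.
have ast : arcpoint s <= arcpoint t by rewrite leNgt ltr_arcpoint -?leNgt; lra.
have atu : arcpoint t <= arcpoint u by rewrite leNgt ltr_arcpoint -?leNgt; lra.
have -> : `]arcpoint s, arcpoint u]%classic =
    `]arcpoint s, arcpoint t]%classic `|` `]arcpoint t, arcpoint u]%classic.
  by rewrite -itv_bndbnd_setU.
rewrite Rintegral_setU//.
  by rewrite -itv_bndbnd_setU//; exact: integrable_arc.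
apply/disj_setPS => x/= []; rewrite !in_itv/=; lra.
Qed.

Lemma Rintegral_arc01 : \int[rho]_(x in `[0%R, 2%R]) f x =
  \int[rho]_(x in `]arcpoint 0, arcpoint 1]) f x.
Proof.
rewrite arcpoint0 arcpoint1; have i02 := integrable02.
have E : `[0, 2]%classic = [set 0 : R] `|` `]0, 2]%classic.
  by rewrite (@setU1itv _ _ _ _ false) ?bnd_simp.
rewrite E in i02 *; rewrite Rintegral_setU//.
  rewrite [X in X + _](_ : _ = 0) ?add0r// /Rintegral.
  rewrite null_set_integral//; last exact: arcsine_set1.
  apply: measurable_funS (measurable_int _ i02) => //; first exact: measurableU.
by apply/disj_setPS => x/= [->]; rewrite in_itv/= ltxx.
Qed.

Lemma Riemann_arc_sum (d e : R) (m : nat) : 0 < d -> m%:R * d <= 1 ->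
  (forall s t, 0 <= s <= 1 -> `|s - t| <= d -> `|h s - h t| <= e) ->
  `|\int[rho]_(x in `]arcpoint 0, arcpoint (m%:R * d)]) f x -
    d * \sum_(j < m) h (j%:R * d)| <= e * (m%:R * d).
Proof.
move=> d0 + he; elim: m => [|m IH] md.
  by rewrite big_ord0 mul0r set_itv_ge ?bnd_simp ?ltxx// Rintegral_set0 !mulr0 subrr normr0.
have m0 : 0 <= m%:R * d by rewrite mulr_ge0// ltW.
have mS : m.+1%:R * d = m%:R * d + d by rewrite -natr1 mulrDl mul1r.
rewrite mS in md *.
have {}IH := IH ltac:(lra).
rewrite (@Rintegral_arcD _ (m%:R * d)) ?lerDl ?(ltW d0)// big_ord_recr/=.
have := @arc_estimate (m%:R * d) (m%:R * d + d) (h (m%:R * d)) e m0 _ md.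
rewrite lerDl (ltW d0) => /(_ isT)/(_ _)/wrap[u umd|].
  by rewrite distrC; apply: he; [lra|rewrite ler0_norm; lra].
rewrite [m%:R * d + d - _]addrAC subrr add0r => arc.
rewrite mulrDr (mulrC d (h _)) opprD addrACA mulrDr.
by rewrite (le_trans (ler_normD _ _))// lerD.
Qed.

(** The steps of length [d n] need not fill the unit interval: what they leave
    out is shorter than one step, so it contributes a vanishing amount. *)
Lemma Riemann_arc_cvg (d : nat -> R) (m : nat -> nat) :
  (forall n, 0 < d n) -> d n @[n --> \oo] --> 0 ->
  (forall n, 1 - d n <= (m n)%:R * d n <= 1) ->
  d n * (\sum_(j < m n) h (j%:R * d n)) @[n --> \oo] -->
  \int[rho]_(x in `[0%R, 2%R]) f x.
Proof.
move=> d0 dcvg md; have [M hM] := comp_arcpoint_bounded.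
have M0 : 0 <= M by apply: le_trans (hM 0).
apply/cvgrPdist_lt => e e0.
have e2 : 0 < e / 2 by rewrite divr_gt0.
have [r r0 hr] := segment_unif_continuous 0 1 continuous_comp_arcpoint e2.
have M1 : 0 < M + 1 by lra.
have eM : 0 < e / 2 / (M + 1) by rewrite divr_gt0.
near=> n.
have dr : d n < r by near: n; exact: cvgr_lt dcvg _ r0.
have dM : d n < e / 2 / (M + 1) by near: n; exact: cvgr_lt dcvg _ eM.
have /andP[md0 md1] := md n.
have mdge0 : 0 <= (m n)%:R * d n by rewrite mulr_ge0// ltW.
rewrite Rintegral_arc01 (@Rintegral_arcD _ ((m n)%:R * d n))//.
have A1 := @Riemann_arc_sum (d n) (e / 2) (m n) (d0 n) md1 _.
have {}A1 := A1 ltac:(move=> s t s01 st; exact: ltW (hr _ _ s01 (le_lt_trans st dr))).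
have A2 := @arc_estimate ((m n)%:R * d n) 1 0 M mdge0 md1 (lexx _) _.
have {}A2 := A2 ltac:(by move=> u _; rewrite subr0).
rewrite mul0r subr0 in A2; rewrite addrAC.
rewrite (le_lt_trans (ler_normD _ _))// (le_lt_trans (lerD A1 A2))//.
move: dM; rewrite ltr_pdivlMr// => dM; nra.
Unshelve. all: by end_near. Qed.

Let average_cvg (u v : nat -> R) (C l : R) : u n @[n --> \oo] --> l ->
  (forall n, `|v n - u n| <= C / n.+1%:R) -> v n @[n --> \oo] --> l.
Proof.
move=> ul uv.
have z : (v n - u n) @[n --> \oo] --> 0.
  apply/norm_cvg0P; apply: (@squeeze_cvgr _ _ _ _ (fun=> 0) (fun n => C * harmonic n)).
  - by apply: nearW => n; rewrite normr_ge0 /=; exact: uv.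
  - exact: cvg_cst.
  - by rewrite -[X in _ --> X](mulr0 C); apply: cvgM; [exact: cvg_cst|exact: cvg_harmonic].
rewrite -(add0r l) (_ : v = (fun n => v n - u n + u n)); first exact: cvgD.
by apply/funext => n; rewrite subrK.
Qed.

(** With one more point than steps, the average over a path is a Riemann sum
    for the step [1 / n.+2] up to an error of order [1 / n]. *)
Lemma path_average_cvg :
  n.+3%:R^-1 * (\sum_(k < n.+3) h (k%:R / n.+2%:R)) @[n --> \oo] -->
  \int[rho]_(x in `[0%R, 2%R]) f x.
Proof.
have [M hM] := comp_arcpoint_bounded.
have M0 : 0 <= M by apply: le_trans (hM 0).
pose d n : R := n.+2%:R^-1.
have md n : n.+2%:R * d n = 1 by rewrite mulfV// pnatr_eq0.
have d0 n : 0 < d n by rewrite invr_gt0.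
apply: (@average_cvg (fun n => d n * \sum_(j < n.+2) h (j%:R * d n)) _ (2 * M)).
  apply: (@Riemann_arc_cvg d (fun n => n.+2)) => //.
  - under eq_fun do rewrite /d -addn1.
    exact: cvg_comp (cvg_addnr 1) cvg_harmonic.
  - by move=> n; rewrite md lexx andbT gerBl ltW.
move=> n; rewrite big_ord_recr/=.
set T := \sum_(j < n.+2) _; set z := h _.
have hT : `|d n * T| <= M.
  rewrite normrM gtr0_norm// -[leRHS]mul1r -(md n) mulrAC mulrC.
  rewrite ler_wpM2r ?(ltW (d0 n))//.
  rewrite (le_trans (ler_norm_sum _ _ _))// (le_trans (ler_sum _ (fun i _ => hM _)))//.
  by rewrite sumr_const card_ord mulr_natl.
have hz := hM (n.+2%:R / n.+2%:R).
have -> : n.+3%:R^-1 * (T + z) - d n * T = n.+3%:R^-1 * (z - d n * T).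
  have : T = n.+2%:R * (d n * T) by rewrite mulrA md mul1r.
  have : n.+3%:R != 0 :> R by rewrite pnatr_eq0.
  move: (d n * T) => w + ->; rewrite -(natr1 n.+2).
  by move: (n.+2%:R : R) => N N0; field.
rewrite normrM gtr0_norm ?invr_gt0// mulrC ler_pM//.
  by rewrite (le_trans (ler_normB _ _))// mulr_natl lerD.
by rewrite lef_pV2 ?posrE// ler_nat; lia.
Qed.

(** Reflecting the second half of the indices onto the first leaves at most three
    unmatched terms: the first, the middle and, for odd [N], one beyond. *)
Let half_sum (g : nat -> R) (N : nat) (M : R) :
  (forall k, (k <= N)%N -> g (N - k)%N = g k) -> (forall k, `|g k| <= M) ->
  `|\sum_(k < N) g k - 2 * \sum_(j < N./2) g j| <= 3 * M.
Proof.
move=> gN gM; set m := N./2.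
have mN : (m <= N)%N by rewrite /m; lia.
have M0 : 0 <= M by apply: le_trans (gM 0%N).
rewrite -!(big_mkord predT g) (big_cat_nat _ (n := m))//=.
have -> : \sum_(m <= k < N) g k = \sum_(0 <= k < N - m) g k.+1.
  rewrite big_nat_rev/= -{1}(add0n m) big_addn; apply: eq_big_nat => i iN.
  by rewrite -(gN i.+1); [congr g; lia|lia].
have -> : \sum_(0 <= k < N - m) g k.+1 =
    \sum_(0 <= j < m) g j.+1 + (odd N)%:R * g m.+1.
  have [oN|oN] := boolP (odd N).
    have -> : (N - m = m.+1)%N by rewrite /m; lia.
    by rewrite big_nat_recr//= mul1r.
  have -> : (N - m = m)%N by rewrite /m; lia.
  by rewrite mul0r addr0.
have -> : \sum_(0 <= j < m) g j.+1 = \sum_(0 <= j < m) g j + g m - g 0%N.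
  by rewrite -big_nat_recr//= big_nat_recl//= addrAC subrr add0r.
set S := \sum_(0 <= j < m) g j.
rewrite (_ : _ - _ = g m - g 0%N + (odd N)%:R * g m.+1); last by ring.
rewrite (le_trans (ler_normD _ _))// (_ : 3 * M = M + M + M); last by ring.
rewrite lerD// ?(le_trans (ler_normB _ _))// ?lerD//.
by case: odd; rewrite ?mul1r// mul0r normr0.
Qed.

(** The eigenvalues of a cycle run through the interval twice, there and back,
    as [arcpoint] is symmetric about 1. One passage is a Riemann sum for the
    step [2 / n.+3]. *)
Lemma cycle_average_cvg :
  n.+3%:R^-1 * (\sum_(k < n.+3) h (2 * k%:R / n.+3%:R)) @[n --> \oo] -->
  \int[rho]_(x in `[0%R, 2%R]) f x.
Proof.
have [M hM] := comp_arcpoint_bounded.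
have M0 : 0 <= M by apply: le_trans (hM 0).
pose d n : R := 2 / n.+3%:R.
have d0 n : 0 < d n by rewrite divr_gt0.
have Nd n : n.+3%:R * d n = 2 by rewrite mulrC divfK// pnatr_eq0.
pose m n := (n.+3)./2.
apply: (@average_cvg (fun n => d n * \sum_(j < m n) h (j%:R * d n)) _ (3 * M)).
  apply: (@Riemann_arc_cvg d m) => //.
  - rewrite -[X in _ --> X](mulr0 2); apply: cvgM; first exact: cvg_cst.
    under eq_fun do rewrite -addn2.
    exact: cvg_comp (cvg_addnr 2) cvg_harmonic.
  - move=> n; have dn := d0 n; have := Nd n.
    have : n.+3%:R = (m n)%:R * 2 + (odd n.+3)%:R :> R.
      by rewrite -natrM -natrD; congr (_%:R); rewrite /m; lia.
    by move=> ->; case: odd; rewrite mulrDl ?mul1r ?mul0r; lra.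
move=> n.
have := @half_sum (fun k => h (k%:R * d n)) n.+3 M.
move=> /(_ _)/wrap[k kN|/(_ (fun k => hM _))].
  rewrite /h natrB// mulrBl Nd /arcpoint mulrBr cosB mulr_natr cos2pi sin2pi.
  by rewrite mul1r mul0r addr0.
rewrite -/(m n); set S := \sum_(j < m n) _ => HS.
under eq_bigr do rewrite mulrC mulrA (mulrC _ 2) -/(d n) mulrC.
set T := \sum_(k < n.+3) _ in HS *.
have -> : n.+3%:R^-1 * T - d n * S = (T - 2 * S) / n.+3%:R by rewrite /d; ring.
rewrite normrM (gtr0_norm (x := _^-1)) ?invr_gt0// ler_pM//.
by rewrite lef_pV2 ?posrE// ler_nat; lia.
Qed.

End Riemann.

(** * Weak convergence *)

Lemma path_weak_cvg (R : realType) (f : R -> R) :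
  {within `[0%R, 2%R], continuous f} ->
  (\int[spectral_measure R (path_graph n)]_(x in `[0%R, 2%R]) (f x)%:E)%E
    @[n --> \oo] --> (\int[@arcsine_measure R]_(x in `[0%R, 2%R]) (f x)%:E)%E.
Proof.
move=> cf; rewrite -(fineK (integrable_fin_num _ (integrable02 cf)))//.
rewrite -(cvg_shiftn 3) /=.
under eq_fun => n.
  rewrite addn3 (integral_spectral_measure (char_poly_path R n.+1)); last 2 first.
  - by move=> k; rewrite -mulrA; exact: arcpoint02.
  - exact: measurable_within02.
  under eq_bigr do rewrite -mulrA.
  rewrite card_ord.
  over.
apply/cvg_EFin; first exact: nearW.
exact: path_average_cvg.
Qed.

Lemma cycle_weak_cvg (R : realType) (f : R -> R) :
  {within `[0%R, 2%R], continuous f} ->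
  (\int[spectral_measure R (cycle_graph n)]_(x in `[0%R, 2%R]) (f x)%:E)%E
    @[n --> \oo] --> (\int[@arcsine_measure R]_(x in `[0%R, 2%R]) (f x)%:E)%E.
Proof.
move=> cf; rewrite -(fineK (integrable_fin_num _ (integrable02 cf)))//.
rewrite -(cvg_shiftn 3) /=.
have angleE (n k : nat) : pi *+ 2 * k%:R / n.+3%:R = pi * (2 * k%:R / n.+3%:R) :> R.
  by ring.
under eq_fun => n.
  rewrite addn3 (integral_spectral_measure (char_poly_cycle R n)); last 2 first.
  - by move=> k; rewrite angleE; exact: arcpoint02.
  - exact: measurable_within02.
  under eq_bigr do rewrite angleE.
  rewrite card_ord.
  over.
apply/cvg_EFin; first exact: nearW.
exact: cycle_average_cvg.
Qed.

Theorem proposition2p5 (R : realType) (G : nat -> sgraph)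
    (hG : (forall n, G n = path_graph n) \/ (forall n, G n = cycle_graph n)) :
  exists rho : {measure set (measurableTypeR R) -> \bar R},
    [/\ in_spectral_class G rho,
        forall A : set R, A `<=` `[0, 2] -> finite_set A -> rho A = 0%E,
        rho `<< mrestr (@lebesgue_measure R) (measurable_itv `[0, 2]),
        rho `[0, 2]%classic = 1%E &
        forall A : set (measurableTypeR R), measurable A -> A `<=` `[0, 2] ->
          rho A = (\int[lebesgue_measure]_(x in A) (limit_density x)%:E)%E].
Proof.
exists (@arcsine_measure R); split.
- split=> [|f cf]; first exact: arcsine_radon.
  case: hG => GE; under eq_fun do rewrite GE.
    exact: path_weak_cvg.
  exact: cycle_weak_cvg.
- move=> A _ /finite_set_countable cA; apply: arcsine_dominated.
    exact: countable_measurable.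
  exact: countable_lebesgue_measure0.
- apply/null_content_dominatesP => A mA A0.
  rewrite -[LHS](arcsine_restrict mA); apply: arcsine_dominated => //.
  exact: measurableI.
- exact: arcsine_total.
- by [].
Qed.
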